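(* Let $X$ be a compact topological space and $f\colon X\to X$ a continuous map. Assume that the induced map $f^*\colon \check H^1(X;\mathbb C)\to\check H^1(X;\mathbb C)$ in Čech cohomology has an eigenvalue $\lambda\in\mathbb C$ with modulus $|\lambda|>1$. Then the topological entropy of $f$ satisfies $h(f)\ge (\log|\lambda|)/d$, where $d\in\mathbb Z^+$ is the degree of the algebraic number $\lambda$ (over $\mathbb Q$). In particular, $h(f)>0$.
   Context: It is implicit in the statement that such an eigenvalue $\lambda$ is an algebraic number. $\check H^q(X;\mathbb C)$ denotes Čech cohomology: the direct limit, over all open coverings $\mathcal U$ of $X$ ordered by refinement, of the simplicial cohomology groups $H^q(N(\mathcal U);\mathbb C)$ of the nerves of the coverings (for compact $X$ finite coverings suffice). Equivalently it is the direct limit of the cohomology of the Vietoris complexes $V(\mathcal U)$, whose vertices are the points of $X$ and whose simplices are the finite nonempty subsets of $X$ contained in some element of $\mathcal U$; or the Alexander--Spanier cohomology of $X$. Topological entropy (Adler--Konheim--McAndrew): for an open covering $\mathcal U$ of the compact space $X$ let $s(\mathcal U)$ be the minimum cardinality of a subcover of $\mathcal U$. Write $\mathcal U\vee\mathcal V=\{U\cap V: U\in\mathcal U,V\in\mathcal V\}$, $f^{-1}\mathcal U=\{f^{-1}(U):U\in\mathcal U\}$ and $\mathcal U^n=\mathcal U\vee f^{-1}\mathcal U\vee\cdots\vee f^{-n}\mathcal U$. Then $h(f,\mathcal U)=\lim_{n\to\infty}\frac1n\log s(\mathcal U^n)$ (the limit exists), and $h(f)=\sup_{\mathcal U}h(f,\mathcal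 U)\in[0,\infty]$, the supremum being over all open coverings of $X$. *)

(* Defs.v *)
From HB Require Import structures.
From mathcomp Require Import all_boot all_order all_algebra finmap.
From mathcomp Require Import generic_quotient.
From mathcomp Require Import all_classical all_reals all_analysis.
From mathcomp Require Import complex ring.

Set Implicit Arguments.
Unset Strict Implicit.
Unset Printing Implicit Defensive.

Import Order.TTheory GRing.Theory Num.Theory.
Import numFieldNormedType.Exports.

Local Open Scope classical_set_scope.
Local Open Scope ring_scope.
Local Open Scope quotient_scope.

Section OpenCovers.
Context {X Y : topologicalType}.
Implicit Types (U V : set (set X)).

Definition open_cover U := U `<=` open /\ \bigcup_(A in U) A = [set: X].

Definition join_cover U V : set (set X) :=
  [set A | exists2 B, U B & exists2 C, V C & A = B `&` C].

Definition preimage_cover (f : X -> Y) (U : set (set Y)) : set (set X) :=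
  [set f @^-1` A | A in U].

End OpenCovers.

Section Entropy.
Context {R : realType} {X : topologicalType}.
Implicit Types (U : set (set X)) (f : X -> X).

Definition has_subcover_of_card U (n : nat) :=
  exists S : {fset set X},
    [/\ [set` S] `<=` U, \bigcup_(A in [set` S]) A = [set: X] & #|` S| = n].

(* The default value 0 is used only when U has no finite subcover. *)
Definition min_subcover_card U : nat :=
  xget 0%N [set n | has_subcover_of_card U n /\
                    forall m, has_subcover_of_card U m -> (n <= m)%N].

Fixpoint iterated_cover f U (n : nat) : set (set X) :=
  if n is m.+1
  then join_cover (iterated_cover f U m) (preimage_cover (iter m.+1 f) U)
  else U.

(* The limit exists, by subadditivity. *)
Definition cover_entropy f U : R :=
  limn (fun n => ln (min_subcover_card (iterated_cover f U n))%:R / n%:R).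

Definition topological_entropy f : \bar R :=
  ereal_sup [set (cover_entropy f U)%:E | U in open_cover].

End Entropy.

Arguments topological_entropy R {X} f.

(* The ordered cochain complex of an abstract simplicial complex N with vertices
   in V. Ordered q-simplices are the lists of q+1 vertices, repetitions allowed,
   that span a simplex. It computes the same cohomology as alternating cochains;
   in degree 1 the two groups are literally equal, since the cocycle condition on
   (x, x, x) and (x, y, x) already makes a 1-cocycle alternating.
   A cochain is represented by a total function on lists, whose values outside N
   are irrelevant to all the definitions below. *)
Section OrderedCochains.
Context {K : fieldType} {V : Type}.
Implicit Types (c b : seq V -> K) (s : seq V) (N : set (seq V)).

Definition coboundary c s : K :=
  \sum_(i < size s) (-1) ^+ i * c (take i s ++ drop i.+1 s).

Definition cocycle q N c :=
  forall s, N s -> size s = q.+2 -> coboundary c s = 0.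

(* The condition b [::] = 0 expresses that there are no cochains of degree -1:
   cohomology is not reduced. *)
Definition cohomologous q N c c' :=
  exists2 b, b [::] = 0 &
    forall s, N s -> size s = q.+1 -> c s - c' s = coboundary b s.

Lemma coboundary_cons c x s :
  coboundary c (x :: s) = c s - coboundary (fun t => c (x :: t)) s.
Proof.
rewrite /coboundary /= big_ord_recl /= mul1r drop0 -sumrN; congr (_ + _).
by apply: eq_bigr => i _; rewrite exprS mulN1r mulNr.
Qed.

Lemma coboundary_nil c : coboundary c [::] = 0.
Proof. by rewrite /coboundary big_ord0. Qed.

Lemma coboundaryD c b s :
  coboundary (fun t => c t + b t) s = coboundary c s + coboundary b s.
Proof.
by rewrite /coboundary -big_split; apply: eq_bigr => i _; rewrite mulrDr.
Qed.

Lemma coboundaryZ a c s :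
  coboundary (fun t => a * c t) s = a * coboundary c s.
Proof.
by rewrite /coboundary big_distrr; apply: eq_bigr => i _; rewrite mulrCA.
Qed.

Lemma coboundaryN c s : coboundary (fun t => - c t) s = - coboundary c s.
Proof. by rewrite /coboundary -sumrN; apply: eq_bigr => i _; rewrite mulrN. Qed.

Lemma coboundary0 s : coboundary (fun=> 0) s = 0.
Proof. by rewrite /coboundary big1// => i _; rewrite mulr0. Qed.

Lemma cocycle0 q N : cocycle q N (fun=> 0).
Proof. by move=> s _ _; rewrite coboundary0. Qed.

Lemma cocycleD q N c c' :
  cocycle q N c -> cocycle q N c' -> cocycle q N (fun s => c s + c' s).
Proof. by move=> h h' s Ns ss; rewrite coboundaryD h// h'// addr0. Qed.

Lemma cocycleZ q N a c : cocycle q N c -> cocycle q N (fun s => a * c s).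
Proof. by move=> h s Ns ss; rewrite coboundaryZ h// mulr0. Qed.

Lemma eq_cohomologous q N c d c' d' : c =1 c' -> d =1 d' ->
  cohomologous q N c d -> cohomologous q N c' d'.
Proof. by move=> /funext -> /funext ->. Qed.

Lemma cohomologous_refl q N c : cohomologous q N c c.
Proof. by exists (fun=> 0) => // s _ _; rewrite subrr coboundary0. Qed.

Lemma cohomologous_sym q N c c' :
  cohomologous q N c c' -> cohomologous q N c' c.
Proof.
move=> [b b0 h]; exists (fun s => - b s); first by rewrite b0 oppr0.
by move=> s Ns ss; rewrite coboundaryN -h// opprB.
Qed.

Lemma cohomologousD q N c c' d d' :
  cohomologous q N c c' -> cohomologous q N d d' ->
  cohomologous q N (fun s => c s + d s) (fun s => c' s + d' s).
Proof.
move=> [b b0 h] [b' b'0 h']; exists (fun s => b s + b' s).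
  by rewrite b0 b'0 addr0.
by move=> s Ns ss; rewrite coboundaryD -h// -h'// opprD addrACA.
Qed.

Lemma cohomologousZ q N a c c' :
  cohomologous q N c c' ->
  cohomologous q N (fun s => a * c s) (fun s => a * c' s).
Proof.
move=> [b b0 h]; exists (fun s => a * b s); first by rewrite b0 mulr0.
by move=> s Ns ss; rewrite coboundaryZ -h// mulrBr.
Qed.

Lemma cohomologous_trans q N c c' c'' :
  cohomologous q N c c' -> cohomologous q N c' c'' -> cohomologous q N c c''.
Proof.
move=> [b b0 h] [b' b'0 h']; exists (fun s => b s + b' s).
  by rewrite b0 b'0 addr0.
by move=> s Ns ss; rewrite coboundaryD -h// -h'// addrA subrK.
Qed.

End OrderedCochains.

Lemma coboundary_map {K : fieldType} {V W : Type} (p : W -> V)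
    (c : seq V -> K) (s : seq W) :
  coboundary (fun t => c (map p t)) s = coboundary c (map p s).
Proof.
rewrite /coboundary size_map; apply: eq_bigr => i _.
by rewrite map_cat map_take map_drop.
Qed.

Section Prism.
Context {K : fieldType} {V W : Type} (p p' : W -> V).
Implicit Types (c : seq V -> K) (s : seq W).

Definition prism c s : K := \sum_(i < size s)
  (-1) ^+ i * c (map p (take i.+1 s) ++ map p' (drop i s)).

Lemma prism_cons c x s : prism c (x :: s) =
  c (p x :: p' x :: map p' s) - prism (fun t => c (p x :: t)) s.
Proof.
rewrite /prism /= big_ord_recl /= mul1r take0 /= -sumrN; congr (_ + _).
by apply: eq_bigr => i _; rewrite exprS mulN1r mulNr.
Qed.

Lemma prism_nil c : prism c [::] = 0.
Proof. by rewrite /prism big_ord0. Qed.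

Lemma prismB c c' s : prism (fun t => c t - c' t) s = prism c s - prism c' s.
Proof. by rewrite /prism -sumrB; apply: eq_bigr => i _; rewrite mulrBr. Qed.

Lemma prism_homotopy c s :
  coboundary (prism c) s + prism (coboundary c) s =
  c (map p' s) - c (map p s).
Proof.
elim: s c => [|x s IH] c /=.
  by rewrite coboundary_nil prism_nil addr0 subrr.
rewrite coboundary_cons prism_cons !coboundary_cons.
have -> : (fun t => prism c (x :: t)) =
    (fun t => c (p x :: p' x :: map p' t) - prism (fun u => c (p x :: u)) t).
  by apply/funext => t; rewrite prism_cons.
have -> : (fun t => coboundary c (p x :: t)) =
    (fun t => c t - coboundary (fun u => c (p x :: u)) t).
  by apply/funext => t; rewrite coboundary_cons.
rewrite coboundaryD coboundaryN prismB.
rewrite (coboundary_map p' (fun u => c (p x :: p' x :: u))).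
have /(canRL (addrK _)) -> := IH (fun u => c (p x :: u)).
set a := coboundary _ _; set b := prism _ _; set d := prism _ _.
ring.
Qed.

End Prism.

Section Nerve.

(* Vertices of the nerve are members of U, and only the nonempty ones span a
   simplex. *)
Definition nerve {X : Type} (U : set (set X)) : set (seq (set X)) :=
  [set s : seq (set X) | {in s, forall A, U A} /\ exists x, {in s, forall A : set X, A x}].

(* With f = id, p is a projection of W onto a cover U that it refines; with
   W = preimage_cover f U it gives the simplicial map induced by f. In all cases
   p induces a simplicial map from nerve W to nerve U, unique up to contiguity. *)
Definition projection {X Y : Type} (f : X -> Y) (W : set (set X))
    (U : set (set Y)) (p : set X -> set Y) :=
  forall B, W B -> U (p B) /\ B `<=` f @^-1` (p B).

Lemma projection_ex {X Y : Type} (f : X -> Y) W U :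
  (forall B, W B -> exists2 A, U A & B `<=` f @^-1` A) ->
  exists p, projection f W U p.
Proof.
move=> h; have /choice[p hp] : forall B, exists A,
    W B -> U A /\ B `<=` f @^-1` A.
  move=> B; have [WB|WB] := pselect (W B); last by exists setT.
  by have [A UA BA] := h B WB; exists A.
by exists p => B /hp.
Qed.

Lemma projection_id {X : Type} (U : set (set X)) : projection id U U id.
Proof. by move=> B UB; split. Qed.

Lemma projection_comp {X Y Z : Type} (f : X -> Y) (g : Y -> Z) W U T p r :
  projection f W U p -> projection g U T r ->
  projection (g \o f) W T (r \o p).
Proof.
move=> hp hr B WB; have [UpB BpB] := hp B WB; have [Tr pr] := hr _ UpB.
by split=> // x /BpB/pr.
Qed.

Context {K : fieldType}.

Lemma nerve_map {X Y : Type} (f : X -> Y) W U p s :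
  projection f W U p -> nerve W s -> nerve U (map p s).
Proof.
move=> hp [sW [x sx]]; split=> [_ /mapP[B Bs ->]|].
  by have [] := hp B (sW B Bs).
exists (f x) => _ /mapP[B Bs ->].
by have [_] := hp B (sW B Bs); apply; exact: sx.
Qed.

Lemma cocycle_map {X Y : Type} (f : X -> Y) W U p q (c : _ -> K) :
  projection f W U p -> cocycle q (nerve U) c ->
  cocycle q (nerve W) (fun s => c (map p s)).
Proof.
move=> hp hc s Ws ss; rewrite coboundary_map hc ?size_map//.
exact: nerve_map hp Ws.
Qed.

Lemma cohomologous_map {X Y : Type} (f : X -> Y) W U p q (c c' : _ -> K) :
  projection f W U p -> cohomologous q (nerve U) c c' ->
  cohomologous q (nerve W) (fun s => c (map p s)) (fun s => c' (map p s)).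
Proof.
move=> hp [b b0 h]; exists (fun s => b (map p s)) => // s Ws ss.
by rewrite coboundary_map h ?size_map//; exact: nerve_map hp Ws.
Qed.

Lemma cohomologous_contiguous {X Y : Type} (f : X -> Y) W U p p' q
    (c : _ -> K) :
  projection f W U p -> projection f W U p' -> cocycle q (nerve U) c ->
  cohomologous q (nerve W) (fun s => c (map p s)) (fun s => c (map p' s)).
Proof.
move=> hp hp' hc; exists (prism p' p c); first by rewrite prism_nil.
move=> s [sW [x sx]] ss; rewrite -prism_homotopy.
suff -> : prism p' p (coboundary c) s = 0 by rewrite addr0.
apply: big1 => i _.
have img B : B \in s -> (U (p B) /\ p B (f x)) /\ (U (p' B) /\ p' B (f x)).
  move=> Bs; have [? +] := hp B (sW B Bs); have [? +] := hp' B (sW B Bs).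
  by move=> /(_ _ (sx B Bs)) ? /(_ _ (sx B Bs)).
rewrite hc ?mulr0//; last first.
  rewrite size_cat !size_map size_takel ?ltn_ord// size_drop.
  by rewrite addSn subnKC ?(ltnW (ltn_ord i))// ss.
split=> [A|]; last exists (f x) => A; rewrite mem_cat => /orP[] /mapP[B Bs ->].
- by have [_ []] := img B (mem_take Bs).
- by have [[]] := img B (mem_drop Bs).
- by have [_ []] := img B (mem_take Bs).
- by have [[]] := img B (mem_drop Bs).
Qed.

End Nerve.

Section DirectedCovers.
Context {X Y : topologicalType}.
Implicit Types (U V W : set (set X)).

Lemma open_coverT : open_cover [set [set: X]].
Proof.
by split=> [_ ->|]; [exact: openT | rewrite bigcup_set1].
Qed.

Lemma open_cover_join U V :
  open_cover U -> open_cover V -> open_cover (join_cover U V).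
Proof.
move=> [Uo UT] [Vo VT]; split=> [_ [B /Uo Bo [C /Vo Co ->]]|].
  exact: openI.
apply/seteqP; split=> // x _.
have [B UB Bx] : (\bigcup_(A in U) A) x by rewrite UT.
have [C VC Cx] : (\bigcup_(A in V) A) x by rewrite VT.
by exists (B `&` C) => //; exists B => //; exists C.
Qed.

Lemma open_cover_preimage (f : X -> Y) (U : set (set Y)) :
  continuous f -> open_cover U -> open_cover (preimage_cover f U).
Proof.
move=> /continuousP fc [Uo UT]; split=> [_ [A /Uo Ao <-]|]; first exact: fc.
apply/seteqP; split=> // x _.
have [A UA Ax] : (\bigcup_(A in U) A) (f x) by rewrite UT.
by exists (f @^-1` A) => //; exists A.
Qed.

Lemma projection_joinl U V : exists p, projection id (join_cover U V) U p.
Proof. by apply: projection_ex => _ [B UB [C VC ->]]; exists B => // x []. Qed.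

Lemma projection_joinr U V : exists p, projection id (join_cover U V) V p.
Proof. by apply: projection_ex => _ [B UB [C VC ->]]; exists C => // x []. Qed.

Lemma projection_preimage (f : X -> Y) (U : set (set Y)) :
  exists p, projection f (preimage_cover f U) U p.
Proof. by apply: projection_ex => _ [A UA <-]; exists A. Qed.

End DirectedCovers.

(* The direct limit of the groups H^q(nerve U), as the quotient of the set of
   pairs (U, c), c a q-cocycle of nerve U, by the relation identifying (U, c)
   and (U', c') when their pullbacks to the nerve of some common refinement are
   cohomologous. *)
Section Cech.
Context {K : fieldType} {X : topologicalType} {q : nat}.

Record cover_cocycle := CoverCocycle {
  cc_cover : set (set X);
  cc_open : open_cover cc_cover;
  cc_cochain : seq (set X) -> K;
  cc_cocycle : cocycle q (nerve cc_cover) cc_cochain }.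

HB.instance Definition _ := gen_eqMixin cover_cocycle.
HB.instance Definition _ := gen_choiceMixin cover_cocycle.

Definition limit_eq (a b : cover_cocycle) := exists W p r,
  [/\ open_cover W, projection id W (cc_cover a) p,
      projection id W (cc_cover b) r &
      cohomologous q (nerve W) (fun s => cc_cochain a (map p s))
                               (fun s => cc_cochain b (map r s))].

Definition limit_eqb (a b : cover_cocycle) : bool := `[< limit_eq a b >].

Lemma limit_eq_refl a : limit_eq a a.
Proof.
exists (cc_cover a), id, id; split; try exact: projection_id.
  exact: cc_open.
exact: cohomologous_refl.
Qed.

Lemma limit_eq_sym a b : limit_eq a b -> limit_eq b a.
Proof.
move=> [W [p [r [Wo hp hr h]]]]; exists W, r, p; split=> //.
exact: cohomologous_sym.
Qed.

Lemma limit_eq_stable a b : limit_eq a b -> exists W, [/\ open_cover W,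
  exists p, projection id W (cc_cover a) p,
  exists r, projection id W (cc_cover b) r &
  forall (Y : topologicalType) (f : Y -> X) T t p r, projection f T W t ->
    projection f T (cc_cover a) p -> projection f T (cc_cover b) r ->
    cohomologous q (nerve T) (fun s => cc_cochain a (map p s))
                             (fun s => cc_cochain b (map r s))].
Proof.
move=> [W [p0 [r0 [Wo hp0 hr0 h]]]]; exists W; split=> //; first by exists p0.
  by exists r0.
move=> Y f T t p r ht hp hr.
have ha := cohomologous_contiguous hp (projection_comp ht hp0) (@cc_cocycle a).
apply: (cohomologous_trans ha).
have hb := cohomologous_contiguous (projection_comp ht hr0) hr (@cc_cocycle b).
apply: cohomologous_trans hb.
by apply: eq_cohomologous (cohomologous_map ht h) => s; rewrite map_comp.
Qed.

Lemma limit_eq_trans a b c : limit_eq a b -> limit_eq b c -> limit_eq a c.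
Proof.
move=> /limit_eq_stable[W [Wo [p hp] [r hr] h]].
move=> /limit_eq_stable[W' [W'o [p' hp'] [r' hr'] h']].
have [t ht] := projection_joinl W W'; have [t' ht'] := projection_joinr W W'.
have pa := projection_comp ht hp; have pc := projection_comp ht' hr'.
have pb := projection_comp ht hr.
exists (join_cover W W'), (p \o t), (r' \o t'); split=> //.
  exact: open_cover_join.
exact: cohomologous_trans (h _ _ _ _ _ _ ht pa pb) (h' _ _ _ _ _ _ ht' pb pc).
Qed.

Lemma limit_eqb_equiv : equiv_class_of limit_eqb.
Proof.
split=> [a|a b|b a c]; first by apply/asboolP; exact: limit_eq_refl.
  by apply/asboolP/asboolP; exact: limit_eq_sym.
move=> /asboolP ab /asboolP bc; apply/asboolP; exact: limit_eq_trans bc.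
Qed.

Canonical limit_eqb_canonical := EquivRelPack limit_eqb_equiv.

Definition cech := {eq_quot limit_eqb}.
HB.instance Definition _ := Choice.on cech.
HB.instance Definition _ := EqQuotient.on cech.

Lemma cech_eqP (a b : cover_cocycle) :
  \pi_cech a = \pi_cech b <-> limit_eq a b.
Proof.
split=> [/eqmodP/asboolP //|h].
by apply/eqmodP/asboolP.
Qed.

Lemma limit_eq_repr (a : cover_cocycle) : limit_eq (repr (\pi_cech a)) a.
Proof. by apply/cech_eqP; rewrite reprK. Qed.

Lemma cech_pullback (a : cover_cocycle) W p (Wo : open_cover W)
    (hp : projection id W (cc_cover a) p) :
  \pi_cech a = \pi_cech (CoverCocycle Wo (cocycle_map hp (@cc_cocycle a))).
Proof.
apply/cech_eqP; exists W, p, id; split=> //=; first exact: projection_id.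
by apply: eq_cohomologous (cohomologous_refl _ _ _) => // s; rewrite map_id.
Qed.

(* Any two classes are represented on a common cover. *)
Lemma cech_common (x : cech) U : open_cover U ->
  exists W p (Wo : open_cover W) c (hc : cocycle q (nerve W) c),
    projection id W U p /\ x = \pi_cech (CoverCocycle Wo hc).
Proof.
move=> Uo; rewrite -[x]reprK; set a := repr x.
have [p hp] := projection_joinl U (cc_cover a).
have [r hr] := projection_joinr U (cc_cover a).
exists (join_cover U (cc_cover a)), p, (open_cover_join Uo (@cc_open a)).
by eexists _, _; split=> //; exact: (cech_pullback _ hr).
Qed.

Lemma cech_rep1 (x : cech) : exists W (Wo : open_cover W) c
  (hc : cocycle q (nerve W) c), x = \pi_cech (CoverCocycle Wo hc).
Proof.
have [W [p [Wo [c [hc [_ ->]]]]]] := cech_common x open_coverT.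
by exists W, Wo, c, hc.
Qed.

Lemma cech_rep2 (x y : cech) : exists W (Wo : open_cover W) c
    (hc : cocycle q (nerve W) c) d (hd : cocycle q (nerve W) d),
  x = \pi_cech (CoverCocycle Wo hc) /\ y = \pi_cech (CoverCocycle Wo hd).
Proof.
have [U [Uo [c [hc ->]]]] := cech_rep1 x.
have [W [p [Wo [d [hd [hp ->]]]]]] := cech_common y Uo.
exists W, Wo, _, (cocycle_map hp hc), d, hd; split=> //.
exact: (@cech_pullback (CoverCocycle Uo hc)).
Qed.

Lemma cech_rep3 (x y z : cech) : exists W (Wo : open_cover W) c
    (hc : cocycle q (nerve W) c) d (hd : cocycle q (nerve W) d)
    e (he : cocycle q (nerve W) e),
  [/\ x = \pi_cech (CoverCocycle Wo hc), y = \pi_cech (CoverCocycle Wo hd)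
    & z = \pi_cech (CoverCocycle Wo he)].
Proof.
have [U [Uo [c [hc [d [hd [-> ->]]]]]]] := cech_rep2 x y.
have [W [p [Wo [e [he [hp ->]]]]]] := cech_common z Uo.
exists W, Wo, _, (cocycle_map hp hc), _, (cocycle_map hp hd), e, he.
split=> //; first exact: (@cech_pullback (CoverCocycle Uo hc)).
exact: (@cech_pullback (CoverCocycle Uo hd)).
Qed.

Lemma cech_cohomologous W (Wo : open_cover W) c d
    (hc : cocycle q (nerve W) c) (hd : cocycle q (nerve W) d) :
  cohomologous q (nerve W) c d ->
  \pi_cech (CoverCocycle Wo hc) = \pi_cech (CoverCocycle Wo hd).
Proof.
move=> cd; apply/cech_eqP; exists W, id, id; split=> //=; try exact: projection_id.
by apply: eq_cohomologous cd => s; rewrite map_id.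
Qed.

Definition cech_zero : cech :=
  \pi_cech (CoverCocycle open_coverT (cocycle0 (q := q) (N := nerve [set setT]))).

Definition cech_add (x y : cech) : cech :=
  let a := repr x in let b := repr y in
  let p := cid (projection_joinl (cc_cover a) (cc_cover b)) in
  let r := cid (projection_joinr (cc_cover a) (cc_cover b)) in
  \pi_cech (CoverCocycle (open_cover_join (@cc_open a) (@cc_open b))
    (cocycleD (cocycle_map (projT2 p) (@cc_cocycle a))
              (cocycle_map (projT2 r) (@cc_cocycle b)))).

Definition cech_scale (k : K) (x : cech) : cech :=
  let a := repr x in
  \pi_cech (CoverCocycle (@cc_open a) (cocycleZ k (@cc_cocycle a))).

Lemma cech_zeroE W (Wo : open_cover W) :
  cech_zero = \pi_cech (CoverCocycle Wo (cocycle0 (q := q) (N := nerve W))).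
Proof.
have hp : projection id W [set [set: X]] (fun=> setT) by [].
rewrite /cech_zero; set a := CoverCocycle _ _; rewrite (@cech_pullback a _ _ Wo hp).
by apply: cech_cohomologous; exact: cohomologous_refl.
Qed.

Lemma cech_addE W (Wo : open_cover W) c d
    (hc : cocycle q (nerve W) c) (hd : cocycle q (nerve W) d) :
  cech_add (\pi_cech (CoverCocycle Wo hc)) (\pi_cech (CoverCocycle Wo hd)) =
  \pi_cech (CoverCocycle Wo (cocycleD hc hd)).
Proof.
rewrite /cech_add; set C := CoverCocycle Wo hc; set D := CoverCocycle Wo hd.
case: cid => p hp; case: cid => r hr /=.
have [W1 [W1o [p1 hp1] [r1 hr1] h1]] := limit_eq_stable (limit_eq_repr C).
have [W2 [W2o [p2 hp2] [r2 hr2] h2]] := limit_eq_stable (limit_eq_repr D).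
set a := repr (\pi_cech C) in p hp r hr p1 hp1 h1 *.
set b := repr (\pi_cech D) in p hp r hr p2 hp2 h2 *.
set J := join_cover (cc_cover a) (cc_cover b) in p hp r hr *.
pose T := join_cover J (join_cover W1 W2).
have To : open_cover T.
  by do !apply: open_cover_join => //; exact: cc_open.
have [t ht] := projection_joinl J (join_cover W1 W2).
have [u hu] := projection_joinr J (join_cover W1 W2).
have [v1 hv1] := projection_joinl W1 W2.
have [v2 hv2] := projection_joinr W1 W2.
have hu1 := projection_comp hu hv1; have hu2 := projection_comp hu hv2.
have hW := projection_comp hu1 hr1.
apply/cech_eqP; exists T, t, (r1 \o (v1 \o u)); split => //=.
apply: cohomologousD.
  apply: eq_cohomologous (h1 _ _ _ _ _ _ hu1 (projection_comp ht hp) hW) => // s.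
  by rewrite map_comp.
apply: eq_cohomologous (h2 _ _ _ _ _ _ hu2 (projection_comp ht hr) hW) => // s.
by rewrite map_comp.
Qed.

Lemma cech_scaleE k W (Wo : open_cover W) c (hc : cocycle q (nerve W) c) :
  cech_scale k (\pi_cech (CoverCocycle Wo hc)) =
  \pi_cech (CoverCocycle Wo (cocycleZ k hc)).
Proof.
rewrite /cech_scale; set C := CoverCocycle Wo hc.
have [W1 [p [r [W1o hp hr h]]]] := limit_eq_repr C.
apply/cech_eqP; exists W1, p, r; split => //=; exact: cohomologousZ.
Qed.

Lemma eq_cech W (Wo : open_cover W) c d
    (hc : cocycle q (nerve W) c) (hd : cocycle q (nerve W) d) :
  c =1 d -> \pi_cech (CoverCocycle Wo hc) = \pi_cech (CoverCocycle Wo hd).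
Proof.
move=> /funext cd; move: hc hd; rewrite cd => hc hd.
by apply: cech_cohomologous; exact: cohomologous_refl.
Qed.

Lemma cech_addA : associative cech_add.
Proof.
move=> x y z.
have [W [Wo [c [hc [d [hd [e [he [-> -> ->]]]]]]]]] := cech_rep3 x y z.
by rewrite !cech_addE; apply: eq_cech => s; rewrite addrA.
Qed.

Lemma cech_addC : commutative cech_add.
Proof.
move=> x y; have [W [Wo [c [hc [d [hd [-> ->]]]]]]] := cech_rep2 x y.
by rewrite !cech_addE; apply: eq_cech => s; rewrite addrC.
Qed.

Lemma cech_add0 : left_id cech_zero cech_add.
Proof.
move=> x; have [W [Wo [c [hc ->]]]] := cech_rep1 x.
by rewrite (cech_zeroE Wo) cech_addE; apply: eq_cech => s; rewrite add0r.
Qed.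

Lemma cech_addN : left_inverse cech_zero (cech_scale (-1)) cech_add.
Proof.
move=> x; have [W [Wo [c [hc ->]]]] := cech_rep1 x.
rewrite (cech_zeroE Wo) cech_scaleE cech_addE.
by apply: eq_cech => s; rewrite mulN1r addNr.
Qed.

HB.instance Definition _ :=
  GRing.isZmodule.Build cech cech_addA cech_addC cech_add0 cech_addN.

Lemma cech_scaleA k l (x : cech) :
  cech_scale k (cech_scale l x) = cech_scale (k * l) x.
Proof.
have [W [Wo [c [hc ->]]]] := cech_rep1 x.
by rewrite !cech_scaleE; apply: eq_cech => s; rewrite mulrA.
Qed.

Lemma cech_scale1 : left_id 1 cech_scale.
Proof.
move=> x; have [W [Wo [c [hc ->]]]] := cech_rep1 x.
by rewrite !cech_scaleE; apply: eq_cech => s; rewrite mul1r.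
Qed.

Lemma cech_scaleDr : right_distributive cech_scale +%R.
Proof.
move=> k x y; have [W [Wo [c [hc [d [hd [-> ->]]]]]]] := cech_rep2 x y.
rewrite [X in cech_scale k X]cech_addE !cech_scaleE [RHS]cech_addE.
by apply: eq_cech => s; rewrite mulrDr.
Qed.

Lemma cech_scaleDl (x : cech) :
  {morph cech_scale^~ x : k l / k + l >-> k + l}.
Proof.
move=> k l; have [W [Wo [c [hc ->]]]] := cech_rep1 x.
rewrite !cech_scaleE [RHS]cech_addE.
by apply: eq_cech => s; rewrite mulrDl.
Qed.

HB.instance Definition _ := GRing.Zmodule_isLmodule.Build K cech
  cech_scaleA cech_scale1 cech_scaleDr cech_scaleDl.

End Cech.

Arguments cover_cocycle : clear implicits.
Arguments cech : clear implicits.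

Section InducedMap.
Context {K : fieldType} {X Y : topologicalType} (q : nat).
Context (f : X -> Y) (fc : continuous f).

(* On nerve (preimage_cover f U) the vertex f @^-1` A is sent to A, for some
   choice of A in U when several members of U have the same preimage. *)
Definition cech_map (y : cech K Y q) : cech K X q :=
  let a := repr y in
  let p := cid (projection_preimage f (cc_cover a)) in
  \pi_(cech K X q) (CoverCocycle (open_cover_preimage fc (@cc_open _ _ _ a))
    (cocycle_map (projT2 p) (@cc_cocycle _ _ _ a))).

Lemma cech_mapE U (Uo : open_cover U) c (hc : cocycle q (nerve U) c)
    W (Wo : open_cover W) p (hp : projection f W U p) :
  cech_map (\pi_(cech K Y q) (CoverCocycle Uo hc)) =
  \pi_(cech K X q) (CoverCocycle Wo (cocycle_map hp hc)).
Proof.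
rewrite /cech_map; set C := CoverCocycle Uo hc.
case: cid => r hr /=.
have [S [So [p1 hp1] [r1 hr1] h]] := limit_eq_stable (limit_eq_repr C).
set a := repr (\pi_(cech K Y q) C) in r hr p1 hp1 h *.
set A := preimage_cover f (cc_cover a) in hr *.
pose T := join_cover (join_cover A W) (preimage_cover f S).
have Ao : open_cover A by apply: open_cover_preimage => //; exact: cc_open.
have To : open_cover T.
  by do !apply: open_cover_join => //; exact: open_cover_preimage.
have [t ht] := projection_joinl (join_cover A W) (preimage_cover f S).
have [u hu] := projection_joinr (join_cover A W) (preimage_cover f S).
have [tA htA] := projection_joinl A W; have [tW htW] := projection_joinr A W.
have [w hw] := projection_preimage f S.
have hA := projection_comp ht htA; have hW := projection_comp ht htW.
apply/cech_eqP; exists T, (tA \o t), (tW \o t); split => //=.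
have := h _ _ _ _ _ _ (projection_comp hu hw) (projection_comp hA hr)
          (projection_comp hW hp).
by apply: eq_cohomologous => s; rewrite map_comp.
Qed.

Lemma cech_map_linear : linear cech_map.
Proof.
move=> k x y; have [W [Wo [c [hc [d [hd [-> ->]]]]]]] := cech_rep2 x y.
have [p hp] := projection_preimage f W.
have Po := open_cover_preimage fc Wo.
rewrite [k *: _]cech_scaleE [X in cech_map X]cech_addE !(cech_mapE _ _ Po hp).
rewrite [k *: _]cech_scaleE [RHS]cech_addE.
exact: eq_cech.
Qed.

HB.instance Definition _ :=
  GRing.isLinear.Build K (cech K Y q) (cech K X q) *:%R cech_map cech_map_linear.

End InducedMap.

Arguments cech_map K {X Y} q {f} fc.

Definition has_eigenvalue {K : fieldType} {V : lmodType K} (phi : {linear V -> V})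
    (l : K) := exists2 v, v != 0 & phi v = l *: v.

(* p is the minimal polynomial of z over the rationals. *)
Definition algebraic_of_degree {L : fieldType} (z : L) (d : nat) :=
  exists p : {poly rat},
    [/\ p \is monic, irreducible_poly p, root (map_poly ratr p) z &
        size p = d.+1].

(* Main.v *)
From HB Require Import structures.
Require Import Defs.
From mathcomp Require Import all_boot all_order all_algebra finmap.
From mathcomp Require Import all_classical all_reals all_analysis.
From mathcomp Require Import complex ring lra zify.

Set Implicit Arguments.
Unset Strict Implicit.
Unset Printing Implicit Defensive.

Import Order.TTheory GRing.Theory Num.Theory.
Import numFieldNormedType.Exports.
Local Open Scope classical_set_scope.
Local Open Scope ring_scope.
Local Open Scope quotient_scope.

(** Represent an eigenvector of f* on H^1 by a cocycle c on a finite open cover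
    U. On some open cover V refining U and f^-1 U, the pullback of c along f is
    lambda c up to a coboundary. Let S be a subcover of least cardinality s_n of
    the iterated cover V^n. Its members lie in members of V under each of
    id, f, ..., f^n, so that c has pullbacks c_0, ..., c_n to the nerve of S, and
    c_j is cohomologous to lambda^j c_0 (iterate_cohomologous).

    The class of c is nonzero in the limit, hence c_0 is not a coboundary, and
    some closed walk in the nerve of S has a nonzero period x. Such a walk can be
    chosen of length at most 2 s_n (nonzero_period): if all these short walks had
    zero period, summing c_0 along simple paths from a root in each component
    would give a potential of c_0. The period of c_j along the same walk is
    lambda^j x. The cochain c takes finitely many values, which are integer
    combinations of finitely many complex numbers a_i linearly independent over
    the integers. So lambda^j x, for all j <= n, is an integer combination of the
    a_i with coefficients O(s_n) (eigen_periods).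

    With k numbers a_i, the coordinate vectors of x, lambda x, ..., lambda^k x are
    linearly dependent, which makes lambda algebraic. Let d be its degree, and
    y_j the coordinate of lambda^j x on some a_i for which y_0 <> 0. This integer
    sequence satisfies every rational linear relation between the powers of
    lambda. Hence the Hankel matrices H_n = (y_(n+i+j)) with 0 <= i, j < d have a
    common left eigenvector u, namely u H_n = lambda^n u H_0, and H_0 is
    nonsingular. Its determinant is a nonzero integer, so that
    |lambda|^n <= |lambda^n det H_0|; and lambda^n det H_0 is an entry of
    u H_n adj(H_0), hence O(s^d) where s bounds the entries (hankel_bound). This
    plays the role of Liouville's inequality and is where the exponent d comes
    from. Thus |lambda|^n = O(s_(n+2d)^d).

    Finally ln s_n / n converges, by subadditivity (subadditive_cvg), so its
    limit, the entropy of f relative to V, is at least ln |lambda| / d. *)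

(** * Integer coordinates and minimal polynomials *)

Definition int_free {C : numFieldType} {k} (a : 'I_k -> C) :=
  forall m : 'I_k -> int, \sum_i (m i)%:~R * a i = 0 -> forall i, m i = 0.

(** Add the values one at a time. A value that depends on the a_i with integer
    coefficients over a denominator D is absorbed by replacing each a_i with
    a_i / D; any other value joins the family. *)
Lemma int_free_coordinates (C : numFieldType) (vs : seq C) :
  exists k (a : 'I_k -> C),
    int_free a /\
    (forall v, v \in vs -> exists m : 'I_k -> int, v = \sum_i (m i)%:~R * a i).
Proof.
elim: vs => [|v vs [k [a [a_free a_span]]]].
  by exists 0%N, (fun=> 0); split => // m _ [].
have [[D [m [D0 Dv]]]|indep] :=
    pselect (exists (D : int) (m : 'I_k -> int),
      D != 0 /\ D%:~R * v = \sum_i (m i)%:~R * a i).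
  have D0' : D%:~R != 0 :> C by rewrite intr_eq0.
  exists k, (fun i => a i / D%:~R); split=> [m' m'0|w].
    apply: a_free; apply: (mulIf (invr_neq0 D0')).
    by rewrite mul0r mulr_suml -[RHS]m'0; apply: eq_bigr => i _; rewrite mulrA.
  rewrite in_cons => /predU1P[->|/a_span[n ->]].
    exists m; apply: (mulfI D0'); rewrite Dv mulr_sumr.
    by apply: eq_bigr => i _; field.
  exists (fun i => D * n i); apply: eq_bigr => i _; rewrite rmorphM/=.
  by field.
exists k.+1, (fun i => oapp a v (unlift ord0 i)); split=> [m|w].
  rewrite big_ord_recl unlift_none /=.
  under eq_bigr do rewrite liftK /=.
  move=> m0; have D0 : m ord0 = 0.
    apply: contrapT => /eqP D0; apply: indep.
    exists (m ord0), (fun i => - m (lift ord0 i)); split=> //.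
    apply/eqP; rewrite -subr_eq0 -[X in _ == X]m0; apply/eqP; congr (_ + _).
    by rewrite -sumrN; apply: eq_bigr => i _; rewrite rmorphN mulNr opprK.
  move: m0; rewrite D0 mul0r add0r => /a_free m0 i.
  by have [j ->|->] := unliftP ord0 i.
rewrite in_cons => /predU1P[->|/a_span[n ->]].
  exists (fun i => if i == ord0 then 1 else 0).
  rewrite big_ord_recl eqxx unlift_none mul1r big1 ?addr0// => i _.
  by rewrite mul0r.
exists (fun i => oapp n 0 (unlift ord0 i)).
rewrite big_ord_recl unlift_none mul0r add0r.
by under [RHS]eq_bigr do rewrite liftK /=.
Qed.

(** The k+1 coordinate vectors of x, l x, ..., l^k x live in a space of dimension
    k, and a linear relation between them is a polynomial that kills l. *)
Lemma algebraic_of_int_coordinates (C : numFieldType) (l x : C) k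
    (a : 'I_k -> C) (y : nat -> 'I_k -> int) :
  x != 0 -> (forall j, (j <= k)%N -> l ^+ j * x = \sum_i (y j i)%:~R * a i) ->
  exists2 q : {poly rat}, q != 0 & root (map_poly ratr q) l.
Proof.
move=> x0 yE.
pose Y : 'M[rat]_(k.+1, k) := \matrix_(j, i) (y j i)%:~R.
have /rowV0Pn[u /sub_kermxP uY u0] : kermx Y != 0.
  rewrite -mxrank_eq0 mxrank_ker -lt0n subn_gt0 ltnS.
  exact: rank_leq_col.
exists (rVpoly u).
  by apply: contra u0 => /eqP/(congr1 (@poly_rV _ k.+1)); rewrite rVpolyK linear0 => ->.
have us : (size (map_poly (@ratr C) (rVpoly u)) <= k.+1)%N.
  by rewrite size_map_poly; exact: size_poly.
rewrite /root (horner_coef_wide _ us) -(mulIr_eq0 _ (mulIf x0)) mulr_suml.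
rewrite (eq_bigr (fun j : 'I_k.+1 =>
    \sum_i ratr (u 0 j * Y j i) * a i)) => [|j _]; last first.
  rewrite coef_map coef_rVpoly_ord /= -mulrA yE -1?ltnS// mulr_sumr.
  by apply: eq_bigr => i _; rewrite mxE rmorphM /= ratr_int mulrA.
rewrite exchange_big big1//= => i _; rewrite -mulr_suml -rmorph_sum.
by have /rowP/(_ i) := uY; rewrite !mxE => ->; rewrite rmorph0 mul0r.
Qed.

Lemma minimal_polynomial_ex (C : numFieldType) (l : C) (q : {poly rat}) :
  q != 0 -> root (map_poly ratr q) l ->
  exists p : {poly rat}, [/\ p \is monic, irreducible_poly p &
    root (map_poly ratr p) l].
Proof.
move=> q0 ql.
pose P n := `[< exists p : {poly rat},
  [/\ p != 0, root (map_poly ratr p) l & size p = n] >].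
have exP : exists n, P n by exists (size q); apply/asboolP; exists q.
have [n /asboolP[p [p0 pl pn]] pmin] := ex_minnP exP.
have {pmin}pmin r : r != 0 -> root (map_poly ratr r) l -> (size p <= size r)%N.
  by move=> r0 rl; rewrite pn; apply: pmin; apply/asboolP; exists r.
have pc : lead_coef p != 0 by rewrite lead_coef_eq0.
have pcV : (lead_coef p)^-1 != 0 by rewrite invr_eq0.
exists ((lead_coef p)^-1 *: p); split; first by rewrite monicE lead_coefZ mulVf.
- split=> [|r rs].
    rewrite size_scale// ltnNge; apply/negP => /size1_polyC pE.
    move: pl p0; rewrite pE map_polyC rootC /= fmorph_eq0 => /eqP ->.
    by rewrite polyC0 eqxx.
  rewrite dvdpZr// => rp.
  rewrite (eqp_rtrans (eqp_scale _ pcV)).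
  have [s pE] := dvdpP _ _ rp.
  move: (p0) (pl); rewrite pE rmorphM rootM mulf_eq0 negb_or => /andP[s0 r0].
  rewrite -pE -dvdp_size_eqp// => /orP[] zl.
    have := pmin _ s0 zl; rewrite pE size_mul//.
    move: rs r0; rewrite -size_poly_eq0; case: (size r) => [|[|m]]// _ _.
    move: s0; rewrite -size_poly_eq0; case: (size s) => [|k]// _.
    by rewrite addnS /= -ltnS addnS ltnS leqNgt leq_addr.
  by rewrite eqn_leq dvdp_leq// pmin.
- by rewrite map_polyZ/= rootZ// fmorph_eq0.
Qed.

(** * Integer sequences satisfying the relations of an algebraic number *)

Section Pairing.
Context (y : nat -> int) (N : nat).

Definition pairing (q : {poly rat}) : rat := \sum_(j < N) q`_j * (y j)%:~R.

Lemma pairing_linear : linear_for *%R pairing.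
Proof.
move=> k p q; rewrite /pairing mulr_sumr -big_split.
by apply: eq_bigr => i _; rewrite coefD coefZ mulrDl mulrA.
Qed.

HB.instance Definition _ :=
  GRing.isLinear.Build rat {poly rat} rat *%R pairing pairing_linear.

Lemma pairingXn j : (j < N)%N -> pairing 'X^j = (y j)%:~R.
Proof.
move=> jN; rewrite /pairing (bigD1 (Ordinal jN))//= coefXn eqxx mul1r.
rewrite big1 ?addr0// => i ij; rewrite coefXn; case: eqP => [e|]; rewrite ?mul0r//.
by move: ij; rewrite -(inj_eq val_inj) /= e eqxx.
Qed.

End Pairing.

(** The case of interest is that of the coordinates of x, l x, l^2 x, ... on one
    member of a free family. *)
Definition relations_hold {C : numFieldType} (l : C) (N : nat) (y : nat -> int) :=
  forall q : {poly rat}, (size q <= N)%N -> root (map_poly ratr q) l ->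
    pairing y N q = 0.

Definition hankel d (y : nat -> int) n : 'M[int]_d.+1 :=
  \matrix_(i, j) y (n + i + j)%N.

Lemma det_norm_le (C : numDomainType) n (A : 'M[C]_n) (B : C) :
  (forall i j, `|A i j| <= B) -> `|\det A| <= n`!%:R * B ^+ n.
Proof.
move=> AB; apply: le_trans (ler_norm_sum _ _ _) _.
have <- := perm.card_Sn n.
rewrite mulr_natl -sumr_const; apply: ler_sum => s _.
rewrite normrM normrX normrN1 expr1n mul1r normr_prod.
rewrite -[X in _ ^+ X](card_ord n) -prodr_const; apply: ler_prod => i _.
by rewrite normr_ge0 AB.
Qed.

(** The degree of l is d+1, the size of mu minus one, so that the Hankel matrices
    are square of that size. *)
Section Hankel.
Context (C : numFieldType) (l : C) (mu : {poly rat}) (d : nat).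
Context (mu_monic : mu \is monic) (mu_irr : irreducible_poly mu).
Context (mu_root : root (map_poly ratr mu) l) (mu_size : size mu = d.+2).

(** A vector killed by the matrix is a polynomial al of degree at most d whose
    product with any be of degree at most d pairs to 0. But al is invertible
    modulo mu, and for be the inverse the product al be pairs to y_0. *)
Lemma hankel_det_neq0 y N : relations_hold l N y -> (d.*2 < N)%N ->
  y 0 != 0 -> \det (hankel d y 0) != 0.
Proof.
move=> yP dN y0; apply/negP => /eqP det0.
pose H : 'M[rat]_d.+1 := map_mx intr (hankel d y 0).
have /eqP/det0P[u u0 uH] : \det H = 0 by rewrite det_map_mx det0.
pose al : {poly rat} := rVpoly u.
have al0 : al != 0.
  by apply: contra u0 => /eqP al0; rewrite -[u]rVpolyK -/al al0 linear0.
have al_size : (size al <= d.+1)%N by exact: size_poly.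
have co : coprimep mu al.
  rewrite irreducible_poly_coprime//; apply/negP => /(dvdp_leq al0).
  by rewrite mu_size ltnNge al_size.
have [[v w] /= vw] := Bezout_eq1_coprimepP _ _ co.
pose be := w %% mu.
have be_size : (size be <= d.+1)%N.
  by rewrite -ltnS -mu_size ltn_modp irredp_neq0.
have : pairing y N (al * be - 1) = 0.
  apply: yP.
    rewrite (leq_trans (size_polyD _ _))// size_polyN size_poly1 geq_max.
    apply/andP; split; last exact: leq_trans dN.
    apply: leq_trans dN; apply: leq_trans (size_polyMleq _ _) _.
    have := leq_add al_size be_size; rewrite addSn addnS addnn.
    by case: (_ + _)%N.
  have -> : al * be - 1 = mu * - (v + al * (w %/ mu)).
    rewrite -vw /be [in v * _ + w * _](divp_eq w mu) [in v * _](mulrC v); ring.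
  by rewrite rmorphM rootM mu_root.
suff -> : pairing y N (al * be - 1) = - (y 0)%:~R.
  by apply/eqP; rewrite oppr_eq0 intr_eq0.
have N0 : (0 < N)%N by exact: leq_ltn_trans dN.
have := pairingXn y N0; rewrite expr0 linearB /= => ->.
rewrite -[RHS]sub0r; congr (_ - _).
have -> : al = \sum_(i < d.+1) u 0 i *: 'X^i.
  by rewrite /al /rVpoly poly_def; apply: eq_bigr => i _; rewrite valK.
have -> : be = \sum_(j < d.+1) be`_j *: 'X^j.
  rewrite -poly_def; apply/polyP => j; rewrite coef_poly; case: ltnP => // jd.
  by rewrite nth_default// (leq_trans be_size).
(* Expand the pairing as the sum of al_i be_j y_(i+j). *)
rewrite mulr_sumr linear_sum big1//= => j _.
rewrite mulr_suml linear_sum /=.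
have /rowP/(_ j) := uH; rewrite !mxE => uHj.
transitivity (be`_j * \sum_i u 0 i * H i j); last by rewrite uHj mulr0.
rewrite mulr_sumr; apply: eq_bigr => i _.
rewrite -scalerAr -scalerAl -exprD !linearZ /= pairingXn.
  by rewrite !mxE.
by rewrite (leq_ltn_trans _ dN)// -addnn leq_add// -ltnS ltn_ord.
Qed.

(** Take for u the coefficients of mu / (X - l). Then u H_n lists the pairings of
    X^(n+j) mu / (X - l), and raising n by one multiplies them by l, since
    X^m mu pairs to 0. *)
Lemma hankel_eigenvector : exists2 u : 'rV[C]_d.+1, u 0 ord_max = 1 &
  forall y N n, relations_hold l N y -> (n + d.*2 < N)%N ->
    u *m map_mx intr (hankel d y n) =
      l ^+ n *: (u *m map_mx intr (hankel d y 0)).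
Proof.
have [U muE] := factor_theorem _ _ mu_root.
have Um : U \is monic.
  have : map_poly (@ratr C) mu \is monic by rewrite map_monic.
  by rewrite muE monicMr// monicXsubC.
have Us : size U = d.+1.
  have : size (map_poly (@ratr C) mu) = d.+2 by rewrite size_map_poly.
  by rewrite muE size_Mmonic ?monic_neq0 ?monicXsubC// size_XsubC addn2 => -[].
have muXU : map_poly ratr mu = 'X * U - l *: U.
  by rewrite muE -mul_polyC; ring.
exists (poly_rV U).
  by rewrite mxE /=; move: Um; rewrite monicE lead_coefE Us => /eqP.
move=> y N n yP nN.
pose z m := \sum_(i < d.+1) U`_i * (y (m + i)%N)%:~R.
(* Compare coefficients in mu = X U - l U, where deg U = d. *)
have zS m : (m + d.+1 < N)%N -> z m.+1 = l * z m.
  move=> mN; have : pairing y N ('X^m * mu) = 0.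
    apply: yP; last by rewrite rmorphM rootM mu_root orbT.
    by rewrite size_monicM ?monicXn ?irredp_neq0// size_polyXn mu_size addSn addnS.
  have -> : 'X^m * mu = \sum_(i < d.+2) mu`_i *: 'X^(m + i).
    rewrite -[in LHS](coefK mu) mu_size poly_def mulr_sumr; apply: eq_bigr => i _.
    by rewrite -scalerAr exprD.
  rewrite linear_sum /=.
  rewrite (eq_bigr (fun i : 'I_d.+2 => mu`_i * (y (m + i)%N)%:~R)); last first.
    move=> i _; rewrite linearZ /= pairingXn//.
    by rewrite (leq_ltn_trans _ mN)// leq_add2l -ltnS.
  move=> /(congr1 (@ratr C)); rewrite rmorph0 rmorph_sum /=.
  rewrite (eq_bigr (fun i : 'I_d.+2 =>
      ('X * U - l *: U)`_i * (y (m + i)%N)%:~R)); last first.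
    by move=> i _; rewrite rmorphM /= ratr_int -coef_map muXU.
  under eq_bigr do rewrite coefD coefN coefZ mulrBl.
  rewrite sumrB => /eqP; rewrite subr_eq0 => /eqP.
  rewrite big_ord_recl coefXM mul0r add0r [RHS]big_ord_recr /=.
  rewrite [U`_d.+1]nth_default ?Us// mulr0 mul0r addr0 => zE.
  rewrite /z mulr_sumr; transitivity (\sum_(i < d.+1)
      ('X * U)`_(lift ord0 i) * (y (m + lift ord0 i)%N)%:~R : C).
    by apply: eq_bigr => i _; rewrite coefXM /= addSnnS.
  by rewrite zE; apply: eq_bigr => i _; rewrite mulrA.
have uH m j : (poly_rV U *m map_mx intr (hankel d y m)) 0 j = z (m + j)%N :> C.
  rewrite mxE /z; apply: eq_bigr => i _; rewrite !mxE.
  by rewrite -addnA [(i + j)%N]addnC addnA.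
apply/rowP => j; rewrite uH mxE uH add0n.
elim: n nN => [|n IH] nN; first by rewrite mul1r.
rewrite addSn zS ?IH ?exprS ?mulrA//; first exact: ltn_trans nN.
rewrite (leq_ltn_trans _ nN)// -addnn; have := ltn_ord j; rewrite ltnS => jd.
by rewrite addSn -addnS -!addnA leq_add2l addnS ltnS addnC leq_add2l.
Qed.

(** The last entry of u H_n adj(H_0) is l^n det(H_0), because u H_n = l^n u H_0 and
    the last entry of u is 1. The factor u H_n is linear in the y_j and the
    adjugate has degree d in them, whereas det(H_0) is a nonzero integer. *)
Lemma hankel_bound : exists2 K : C, 0 <= K &
  forall (y : nat -> int) N (B : C) n, relations_hold l N y -> y 0 != 0 ->
    (forall j, (j < N)%N -> `|(y j)%:~R| <= B) -> (n + d.*2 < N)%N ->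
    `|l| ^+ n <= K * B ^+ d.+1.
Proof.
have [u u1 uH] := hankel_eigenvector.
exists ((\sum_i `|u 0 i|) * d`!%:R *+ d.+1).
  by rewrite mulrn_wge0// mulr_ge0// sumr_ge0.
move=> y N B n yP y0 yB nN.
pose H m : 'M[C]_d.+1 := map_mx intr (hankel d y m).
have HB m i j : (m + d.*2 < N)%N -> `|H m i j| <= B.
  move=> mN; rewrite !mxE yB// -addnA (leq_ltn_trans _ mN)// leq_add2l -addnn.
  by rewrite leq_add// -ltnS ltn_ord.
have N0 : (d.*2 < N)%N by apply: leq_ltn_trans nN; exact: leq_addl.
have detH : 1 <= `|\det (H 0)|.
  rewrite det_map_mx -intr_norm -[1]/(1%:~R) ler_int -gtz0_ge1 normr_gt0.
  exact: hankel_det_neq0 N0 y0.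
have : l ^+ n * \det (H 0) = (u *m H n *m \adj (H 0)) 0 ord_max.
  rewrite (uH _ _ _ yP nN) -scalemxAl -mulmxA mul_mx_adj mul_mx_scalar.
  by rewrite !mxE u1 mulr1.
move=> /(congr1 Num.norm); rewrite normrM normrX mxE => lH.
have : `|l| ^+ n <= `|l| ^+ n * `|\det (H 0)| by rewrite ler_peMr// exprn_ge0.
move=> /le_trans; apply; rewrite lH; apply: le_trans (ler_norm_sum _ _ _) _.
rewrite mulrnAl -[X in _ *+ X](card_ord d.+1) -sumr_const; apply: ler_sum => j _.
rewrite normrM exprS mulrACA; apply: ler_pM => //.
  rewrite mxE (le_trans (ler_norm_sum _ _ _))// mulr_suml; apply: ler_sum => i _.
  by rewrite normrM ler_wpM2l// HB.
rewrite mxE /cofactor normrM normrX normrN1 expr1n mul1r.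
by apply: det_norm_le => i i'; rewrite mxE [X in `|X|]mxE HB.
Qed.

(** Clear the denominators of a relation, evaluate it at l, multiply by x and
    compare coordinates. *)
Lemma relations_hold_coordinate k (a : 'I_k -> C) (x : C)
    (y : nat -> 'I_k -> int) N i :
  int_free a ->
  (forall j, (j < N)%N -> l ^+ j * x = \sum_i (y j i)%:~R * a i) ->
  relations_hold l N (fun j => y j i).
Proof.
move=> a_free yE q qN; have [p [c c0 qE]] := rat_poly_scale q.
have c0' : c%:~R^-1 != 0 :> rat by rewrite invr_eq0 intr_eq0.
rewrite qE map_polyZ rootZ ?fmorph_eq0// => pl.
have pN : (size p <= N)%N by move: qN; rewrite qE size_scale// size_rat_int_poly.
rewrite linearZ /= /pairing; apply/eqP; rewrite mulf_eq0 (negPf c0') /=.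
apply/eqP; transitivity ((\sum_(j < N) p`_j * y j i)%:~R : rat).
  rewrite rmorph_sum; apply: eq_bigr => j _.
  by rewrite rmorphM /= coef_map.
rewrite (a_free (fun i => \sum_(j < N) p`_j * y j i))//.
transitivity ((map_poly ratr (map_poly (intr : int -> rat) p)).[l] * x); last first.
  by rewrite (eqP pl) mul0r.
rewrite (@horner_coef_wide _ N) ?size_map_poly ?size_rat_int_poly//.
rewrite mulr_suml; under [RHS]eq_bigr do rewrite -mulrA yE// mulr_sumr.
rewrite exchange_big; apply: eq_bigr => i' _.
rewrite rmorph_sum mulr_suml; apply: eq_bigr => j _.
by rewrite rmorphM /= !coef_map /= ratr_int mulrA.
Qed.

Lemma eigenvalue_growth k (a : 'I_k -> C) :
  int_free a ->
  exists2 K : C, 0 <= K &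
  forall (x : C) (y : nat -> 'I_k -> int) n (B : C), x != 0 ->
    (forall j, (j <= n + d.*2)%N -> l ^+ j * x = \sum_i (y j i)%:~R * a i) ->
    (forall j i, (j <= n + d.*2)%N -> `|(y j i)%:~R| <= B) ->
    `|l| ^+ n <= K * B ^+ d.+1.
Proof.
move=> a_free; have [K K0 bound] := hankel_bound.
exists K => // x y n B x0 yE yB.
have [i y0] : exists i, y 0 i != 0.
  apply: contrapT => /forallNP y0; case/negP: x0.
  rewrite -[x]mul1r -(expr0 l) yE// big1// => i _.
  by have /negP := y0 i; rewrite negbK => /eqP ->; rewrite mul0r.
apply: (bound (fun j => y j i) (n + d.*2).+1) => // [|j]; last exact: yB.
by apply: relations_hold_coordinate a_free _ => j; exact: yE.
Qed.

End Hankel.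

(** * Subadditive sequences and the entropy of a cover *)

Lemma near_infty_div_le (R : realType) (A e : R) : 0 < e ->
  \forall n \near \oo, A / n%:R <= e.
Proof.
move=> e0; near=> n.
have n0 : 0 < n%:R :> R by rewrite ltr0n; near: n; exact: nbhs_infty_gt.
rewrite ler_pdivrMr// -ler_pdivrMl// mulrC.
by near: n; exact: nbhs_infty_ger.
Unshelve. all: by end_near. Qed.

(** Fekete's lemma, with the index shifted by one: n |-> a (n - 1) is subadditive.
    The limit is the infimum of a n / (n + 1). *)
Lemma subadditive_cvg (R : realType) (a : nat -> R) :
  (forall n, 0 <= a n) -> (forall n m, a (n + m).+1 <= a n + a m) ->
  cvgn (fun n => a n / n%:R).
Proof.
move=> a0 aD; pose b := [set a n / n.+1%:R | n in [set: nat]].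
have b_inf : has_inf b.
  split; first by exists (a 0%N / 1%:R), 0%N.
  by exists 0 => _ [n _ <-]; rewrite divr_ge0.
apply/cvg_ex; exists (inf b); apply/cvgrPdist_le => e e0 /=.
have e2 : 0 < e / 2 by rewrite divr_gt0.
have [_ [m _ <-] bm] := inf_adherent e2 b_inf.
pose A := \sum_(r < m.+1) a r.
(* Write n = r + q (m + 1) and apply the inequality q times. *)
have aA q r : (r < m.+1)%N -> a (r + q * m.+1)%N <= q%:R * a m + A.
  move=> rm; elim: q => [|q IH].
    rewrite mul0n addn0 mul0r add0r /A (bigD1 (Ordinal rm))//=.
    by rewrite lerDl sumr_ge0.
  rewrite (_ : (r + q.+1 * m.+1)%N = ((r + q * m.+1) + m).+1); last lia.
  by rewrite (le_trans (aD _ _))// -natr1; lra.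
near=> n.
have n0 : 0 < n%:R :> R by rewrite ltr0n; near: n; exact: nbhs_infty_gt.
have An : A / n%:R <= e / 2 by near: n; exact: near_infty_div_le.
have lo : inf b <= a n / n%:R.
  apply: (@le_trans _ _ (a n / n.+1%:R)).
    by apply: ge_inf; [exact: b_inf.2|exists n].
  by apply: ler_wpM2l => //; rewrite lef_pV2 ?posrE// ler_nat.
rewrite ler_distlC; apply/andP; split; first by lra.
have nE : a n <= n%:R * (a m / m.+1%:R) + A.
  rewrite {1}(divn_eq n m.+1) addnC.
  apply: le_trans (aA _ _ _) _; first by rewrite ltn_mod.
  rewrite lerD2r mulrA mulrAC ler_wpM2r// ler_pdivlMr// -natrM ler_nat.
  exact: leq_trunc_div.
have : a n / n%:R <= a m / m.+1%:R + A / n%:R.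
  by rewrite ler_pdivrMr// mulrDl divfK ?gt_eqF// mulrC.
move=> /le_trans; apply; rewrite [e]splitr addrA.
exact: lerD (ltW bm) An.
Unshelve. all: by end_near. Qed.

Lemma limn_div_ge (R : realType) (a : nat -> R) (r K : R) :
  cvgn (fun n => a n / n%:R) -> (forall n, n%:R * r - K <= a n) ->
  r <= limn (fun n => a n / n%:R).
Proof.
move=> a_cvg aK; apply/ler_addgt0Pr => e e0; rewrite -lerBlDr.
apply: limr_ge => //; near=> n.
have n0 : 0 < n%:R :> R by rewrite ltr0n; near: n; exact: nbhs_infty_gt.
have Kn : K / n%:R <= e by near: n; exact: near_infty_div_le.
apply: (@le_trans _ _ (r - K / n%:R)); first by lra.
by rewrite ler_pdivlMr// mulrBl divfK ?gt_eqF// mulrC.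
Unshelve. all: by end_near. Qed.

(** A base point makes X a pointed space, and for these compactness by filters and
    by open covers agree; the empty space is trivial. *)
Lemma compact_finite_subset_cover (X : topologicalType) :
  compact [set: X] -> cover_compact [set: X].
Proof.
move=> X_compact.
have [[x _]|/set0P/negP/negPn/eqP X0] := pselect ([set: X] !=set0); last first.
  by rewrite X0 => I D f _ _; exists fset0.
pose Y : ptopologicalType := HB.pack X (isPointed.Build X x).
by move: (X_compact : compact [set: Y]); rewrite compact_cover.
Qed.

Section MinSubcover.
Context {X : topologicalType} (X_compact : compact [set: X]).
Implicit Types (U V : set (set X)) (f : X -> X).

Lemma finite_subcover U : open_cover U ->
  exists S : {fset set X}, [set` S] `<=` U /\ open_cover [set` S].
Proof.
move=> [Uo UT]; have /(_ _ U id Uo) := compact_finite_subset_cover X_compact.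
rewrite /cover UT => /(_ (@subset_refl _ _))[S SU ST].
exists S; have SU' : [set` S] `<=` U by move=> A /SU; rewrite inE.
by split=> //; split; [move=> A /SU'/Uo|apply/seteqP].
Qed.

Lemma min_subcoverP U : open_cover U ->
  has_subcover_of_card U (min_subcover_card U) /\
  forall m, has_subcover_of_card U m -> (min_subcover_card U <= m)%N.
Proof.
move=> Uo; rewrite /min_subcover_card; case: xgetP => [_ -> //|noP].
have [S [SU [_ ST]]] := finite_subcover Uo.
have exP : exists n, `[< has_subcover_of_card U n >].
  by exists #|` S|; apply/asboolP; exists S.
have [n /asboolP Un n_min] := ex_minnP exP.
by have [] := noP n; split=> // m Um; apply: n_min; apply/asboolP.
Qed.

Lemma min_subcover_card_gt0 U (x : X) : open_cover U ->
  (0 < min_subcover_card U)%N.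
Proof.
move=> /min_subcoverP[[S [_ ST <-]] _].
have [A /= AS _] : (\bigcup_(A in [set` S]) A) x by rewrite ST.
by rewrite cardfs_gt0; apply/fset0Pn; exists A.
Qed.

Context {f : X -> X} (f_cont : continuous f).

Lemma iter_continuous n : continuous (iter n f).
Proof.
elim: n => [|n IH] x; first exact: cvg_id.
by apply: continuous_comp; [exact: IH|exact: f_cont].
Qed.

Lemma open_iterated_cover U n : open_cover U -> open_cover (iterated_cover f U n).
Proof.
move=> Uo; elim: n => [//|n IH]; apply: open_cover_join => //.
by apply: open_cover_preimage => //; exact: (@iter_continuous n.+1).
Qed.

Lemma iterated_coverD U n m A B :
  iterated_cover f U n A -> iterated_cover f U m B ->
  iterated_cover f U (n + m).+1 (A `&` iter n.+1 f @^-1` B).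
Proof.
move=> UA; elim: m B => [|m IH] B.
  rewrite addn0 => UB; exists A => //.
  by exists (iter n.+1 f @^-1` B) => //; exists B.
move=> [B' UB' [_ [C UC <-] ->]]; rewrite addnS.
exists (A `&` iter n.+1 f @^-1` B'); first exact: IH.
exists (iter (n + m).+2 f @^-1` C); first by exists C.
have -> : iter (n + m).+2 f = iter m.+1 f \o iter n.+1 f.
  by apply/funext => x /=; rewrite -!iterS -iterD; congr (iter _ f x); lia.
by rewrite preimage_setI setIA comp_preimage.
Qed.

(** Intersecting the members of a subcover of U^n with the preimages under
    f^(n+1) of those of a subcover of U^m gives a subcover of U^(n+m+1). *)
Lemma min_subcover_card_submul U n m : open_cover U ->
  (min_subcover_card (iterated_cover f U (n + m).+1) <=
   min_subcover_card (iterated_cover f U n) *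
   min_subcover_card (iterated_cover f U m))%N.
Proof.
move=> Uo.
have [[S [SU ST <-]] _] := min_subcoverP (open_iterated_cover n Uo).
have [[T [TU TT <-]] _] := min_subcoverP (open_iterated_cover m Uo).
have [_ min] := min_subcoverP (open_iterated_cover (n + m).+1 Uo).
pose l := [seq A `&` iter n.+1 f @^-1` B | A <- enum_fset S, B <- enum_fset T].
apply: (@leq_trans #|` seq_fset tt l|%fset); last first.
  apply: (@leq_trans (size l)); last by rewrite size_allpairs.
  by rewrite size_seq_fset size_undup.
apply: min; exists (seq_fset tt l); split=> //.
  move=> D DJ; have /allpairsP[[A B] /= [AS BT ->]] : D \in l.
    by rewrite -(seq_fsetE tt).
  by apply: iterated_coverD; [exact: SU|exact: TU].
apply/seteqP; split=> // x _.
have [A AS Ax] : (\bigcup_(A in [set` S]) A) x by rewrite ST.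
have [B BT Bx] : (\bigcup_(B in [set` T]) B) (iter n.+1 f x) by rewrite TT.
exists (A `&` iter n.+1 f @^-1` B) => //.
have : A `&` iter n.+1 f @^-1` B \in l by apply/allpairsP; exists (A, B).
by rewrite -(seq_fsetE tt).
Qed.

Lemma cover_entropy_ge (R : realType) (U : set (set X)) (x : X) (r K : R) :
  open_cover U ->
  (forall n, n%:R * r - K <= ln (min_subcover_card (iterated_cover f U n))%:R) ->
  r <= cover_entropy f U.
Proof.
move=> Uo lnK; apply: limn_div_ge lnK.
have s1 n : 1 <= (min_subcover_card (iterated_cover f U n))%:R :> R.
  by rewrite ler1n (min_subcover_card_gt0 x)//; exact: open_iterated_cover.
apply: subadditive_cvg => [n|n m]; first by rewrite ln_ge0.
have s0 k : 0 < (min_subcover_card (iterated_cover f U k))%:R :> R.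
  exact: lt_le_trans (s1 k).
rewrite -lnM ?posrE// ler_ln ?posrE ?mulr_gt0// -natrM ler_nat.
exact: min_subcover_card_submul.
Qed.

End MinSubcover.

(** * Sums along walks and potentials *)

Section WalkSum.
Context {T : Type} {A : zmodType}.
Implicit Types (g : T -> T -> A) (x : T) (p : seq T).

Fixpoint walk_sum g x p : A :=
  if p is y :: p' then g x y + walk_sum g y p' else 0.

Lemma walk_sum_cat g x p r :
  walk_sum g x (p ++ r) = walk_sum g x p + walk_sum g (last x p) r.
Proof. by elim: p x => [|y p IH] x /=; rewrite ?add0r// IH addrA. Qed.

Lemma walk_sum_telescope (e : rel T) g g' (b : T -> A) x p :
  (forall y z, e y z -> g y z - g' y z = b z - b y) -> path e x p ->
  last x p = x -> walk_sum g x p = walk_sum g' x p.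
Proof.
move=> gb ep ex; apply/eqP; rewrite -subr_eq0; apply/eqP.
transitivity (b (last x p) - b x); last by rewrite ex subrr.
elim: p x ep {ex} => [|y p IH] x /=; first by rewrite !subrr.
by move=> /andP[xy /IH yp]; rewrite opprD addrACA gb// yp addrC addrA subrK.
Qed.

End WalkSum.

Lemma walk_sum_map (T T' : Type) (A : zmodType) (h : T' -> T) (g : T -> T -> A) x p :
  walk_sum g (h x) (map h p) = walk_sum (fun y z => g (h y) (h z)) x p.
Proof. by elim: p x => //= y p IH x; rewrite IH. Qed.

Lemma walk_sum_int_combination (T : Type) (C : numFieldType) k (a : 'I_k -> C)
    (e : rel T) (g : T -> T -> C) (m : T -> T -> 'I_k -> int) x p :
  (forall y z, e y z -> g y z = \sum_i (m y z i)%:~R * a i) -> path e x p ->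
  walk_sum g x p = \sum_i (walk_sum (fun y z => m y z i) x p)%:~R * a i.
Proof.
move=> gm; elim: p x => [|y p IH] x /=.
  by move=> _; rewrite big1// => i _; rewrite mul0r.
move=> /andP[xy /IH ->]; rewrite gm// -big_split; apply: eq_bigr => i _.
by rewrite rmorphD mulrDl.
Qed.

Lemma walk_sum_norm_le (T : Type) (A : numDomainType) (e : rel T)
    (g : T -> T -> A) M x p :
  (forall y z, e y z -> `|g y z| <= M) -> path e x p ->
  `|walk_sum g x p| <= M *+ size p.
Proof.
move=> gM; elim: p x => [|y p IH] x /=; first by rewrite normr0.
move=> /andP[xy /IH yp]; rewrite (le_trans (ler_normD _ _))// mulrS.
by rewrite lerD// gM.
Qed.

(** The sum along a simple path from a root of the component is the natural
    candidate for a potential. It works when g sums to 0 along two kinds of closed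
    walks: from the root to y and back, and from the root to x, along the edge
    (x, y), and back from y. As simple paths have fewer than #|T| edges, these
    walks have at most twice #|T| edges. *)
Lemma closed_walk_or_potential (T : finType) (A : zmodType) (e : rel T)
    (g : T -> T -> A) : symmetric e ->
  (exists x p, [/\ path e x p, last x p = x, (size p <= 2 * #|T|)%N &
                   walk_sum g x p != 0]) \/
  (exists b : T -> A, forall x y, e x y -> g x y = b y - b x).
Proof.
move=> e_sym; have [|noW] := pselect (exists x p, [/\ path e x p, last x p = x,
  (size p <= 2 * #|T|)%N & walk_sum g x p != 0]); [by left|right].
have short x y : connect e x y ->
    exists p, [/\ path e x p, last x p = y & (size p < #|T|)%N].
  move=> /connectP[p0 + ->] => /shortenP[p ep up _]; exists p; split=> //.
  by have /card_uniqP /= <- := up; exact: max_card.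
have c_sym : connect_sym e := sym_connect_sym e_sym.
have /choice[P Pp] x : exists p, [/\ path e (fingraph.root e x) p,
    last (fingraph.root e x) p = x & (size p < #|T|)%N].
  by apply: short; rewrite c_sym; exact: connect_root.
have /choice[Q Qp] x : exists p, [/\ path e x p,
    last x p = fingraph.root e x & (size p < #|T|)%N].
  by apply: short; exact: connect_root.
have closed0 x p : path e x p -> last x p = x -> (size p <= 2 * #|T|)%N ->
    walk_sum g x p = 0.
  by move=> ep xp sp; apply: contrapT => /eqP p0; apply: noW; exists x, p.
exists (fun x => walk_sum g (fingraph.root e x) (P x)) => x y xy.
have rxy : fingraph.root e x = fingraph.root e y.
  exact/(fingraph.rootP c_sym)/connect1.
have [ePx lPx sPx] := Pp x; have [ePy lPy sPy] := Pp y; have [eQ lQ sQ] := Qp y.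
have PQ0 : walk_sum g (fingraph.root e y) (P y) + walk_sum g y (Q y) = 0.
  rewrite -[X in walk_sum g X (Q y)]lPy -walk_sum_cat; apply: closed0.
  - by rewrite cat_path ePy lPy.
  - by rewrite last_cat lPy.
  - by rewrite size_cat; lia.
have PgQ0 : walk_sum g (fingraph.root e x) (P x) + (g x y + walk_sum g y (Q y)) = 0.
  rewrite -[g x y + _]/(walk_sum g x (y :: Q y)).
  rewrite -[X in walk_sum g X (y :: _)]lPx -walk_sum_cat; apply: closed0.
  - by rewrite cat_path ePx lPx /= xy.
  - by rewrite last_cat lPx /= lQ rxy.
  - by rewrite size_cat [size (y :: _)]/=; lia.
move/eqP: PQ0; rewrite addr_eq0 => /eqP ->.
move/eqP: PgQ0; rewrite addr_eq0 => /eqP ->.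
by rewrite opprK addrC addrK.
Qed.

(** * Periods of 1-cochains along closed walks in the nerve *)

Section NerveWalks.
Context {K : fieldType} {X : Type}.
Implicit Types (c : seq (set X) -> K) (W : set (set X)).

Definition nerve_edge W : rel (set X) := fun A B => `[< nerve W [:: A; B] >].

Definition period c (A : set X) p := walk_sum (fun B D => c [:: B; D]) A p.

Lemma cohomologous_period W c c' A p :
  cohomologous 1 (nerve W) c c' -> path (nerve_edge W) A p -> last A p = A ->
  period c A p = period c' A p.
Proof.
move=> [b _ cb]; apply: (walk_sum_telescope (b := fun B => b [:: B])) => B D.
move=> /asboolP WBD; rewrite cb// /coboundary /= big_ord_recl big_ord1 /=.
by rewrite mul1r mulN1r.
Qed.

(** A 1-cochain with a potential on the edges of the nerve is a coboundary. *)
Lemma nonzero_period (S : {fset set X}) c :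
  ~ cohomologous 1 (nerve [set` S]) c (fun=> 0) ->
  exists A p, [/\ path (nerve_edge [set` S]) A p, last A p = A,
    (size p <= 2 * #|` S|)%N & period c A p != 0].
Proof.
move=> c_nz.
pose e : rel S := fun A B => nerve_edge [set` S] (val A) (val B).
have e_sym : symmetric e.
  move=> A B; apply/asboolP/asboolP => -[sS [x sx]]; split=> [D|].
  - by rewrite !inE orbC => DBA; apply: sS; rewrite !inE.
  - by exists x => D; rewrite !inE orbC => DBA; apply: sx; rewrite !inE.
  - by rewrite !inE orbC => DBA; apply: sS; rewrite !inE.
  - by exists x => D; rewrite !inE orbC => DBA; apply: sx; rewrite !inE.
have [[A [p [ep lp sp c0]]]|[b cb]] :=
    closed_walk_or_potential (fun A B : S => c [:: val A; val B]) e_sym.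
  exists (val A), (map val p); split.
  - by rewrite path_map.
  - by rewrite last_map lp.
  - by rewrite size_map cardfE.
  - by rewrite /period walk_sum_map.
case: c_nz; exists (fun s => if s is [:: A] then oapp b 0 (insub A) else 0) => //.
move=> [|A [|B []]]// sS _.
have AS : A \in S by apply: sS.1; rewrite !inE eqxx.
have BS : B \in S by apply: sS.1; rewrite !inE eqxx orbT.
rewrite subr0 /coboundary /= big_ord_recl big_ord1 /= mul1r mulN1r.
rewrite !insubT /=; apply: (cb [` AS]%fset [` BS]%fset).
by apply/asboolP.
Qed.

End NerveWalks.

(** * Cocycles on which f acts by a scalar *)

Section EigenCocycle.
Context {X : topologicalType} {f : X -> X}.

Lemma iterated_projection (V : set (set X)) n : exists r : nat -> set X -> set X,
  forall j, (j <= n)%N -> projection (iter j f) (iterated_cover f V n) V (r j).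
Proof.
suff /choice[r rP] j : exists q, (j <= n)%N ->
    projection (iter j f) (iterated_cover f V n) V q by exists r.
have [jn|] := leqP j n; last by exists id.
suff [q hq] : exists q, projection (iter j f) (iterated_cover f V n) V q.
  by exists q.
elim: n jn => [|n IH].
  by rewrite leqn0 => /eqP ->; exists id; exact: projection_id.
rewrite leq_eqVlt => /predU1P[->|jn].
  have [t ht] :=
    projection_joinr (iterated_cover f V n) (preimage_cover (iter n.+1 f) V).
  have [u hu] := projection_preimage (iter n.+1 f) V.
  by exists (u \o t); exact: projection_comp ht hu.
have [t ht] :=
  projection_joinl (iterated_cover f V n) (preimage_cover (iter n.+1 f) V).
have [u hu] := IH jn.
by exists (u \o t); exact: projection_comp ht hu.
Qed.

Context {K : fieldType} {q : nat} {U V : set (set X)}.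
Context {c : seq (set X) -> K} {l : K}.
Context {p rho : set X -> set X}.
Context (c_cocycle : cocycle q (nerve U) c).
Context (p_proj : projection id V U p) (rho_proj : projection f V U rho).
Context (c_eigen : cohomologous q (nerve V)
  (fun s => c (map rho s)) (fun s => l * c (map p s))).

(** Pulling back the relation between the pullbacks of c along r_j turns
    c (rho r_j) into l c (p r_j), up to a coboundary; and rho r_j may be replaced
    with p r_(j+1), as both are projections over f^(j+1). *)
Lemma iterate_cohomologous W r n :
  (forall j, (j <= n)%N -> projection (iter j f) W V (r j)) ->
  forall j, (j <= n)%N -> cohomologous q (nerve W)
    (fun s => c (map (p \o r j) s)) (fun s => l ^+ j * c (map (p \o r 0%N) s)).
Proof.
move=> hr; elim=> [|j IH] jn.
  apply: eq_cohomologous (cohomologous_refl _ _ _) => // s.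
  by rewrite mul1r.
have hj := hr j (ltnW jn).
have := cohomologous_contiguous (projection_comp (hr _ jn) p_proj)
  (projection_comp hj rho_proj) c_cocycle.
move=> /cohomologous_trans; apply.
have eigen_j : cohomologous q (nerve W) (fun s => c (map (rho \o r j) s))
    (fun s => l * c (map (p \o r j) s)).
  by apply: eq_cohomologous (cohomologous_map hj c_eigen) => s; rewrite map_comp.
apply: (cohomologous_trans eigen_j).
apply: eq_cohomologous (cohomologousZ l (IH (ltnW jn))) => // s.
by rewrite exprS mulrA.
Qed.

End EigenCocycle.

(** The cochain c is given with integer coordinates bounded by M of its values on
    pairs of members of U, and its class is assumed to be nonzero in the direct
    limit. *)
Section Periods.
Context {X : topologicalType} (X_compact : compact [set: X]).
Context {f : X -> X} (f_cont : continuous f).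
Context {C : numFieldType} {U : {fset set X}} {V : set (set X)}.
Context {c : seq (set X) -> C} {l : C} {p rho : set X -> set X}.
Context (V_open : open_cover V) (c_cocycle : cocycle 1 (nerve [set` U]) c).
Context (p_proj : projection id V [set` U] p).
Context (rho_proj : projection f V [set` U] rho).
Context (c_eigen : cohomologous 1 (nerve V)
  (fun s => c (map rho s)) (fun s => l * c (map p s))).
Context (c_nontrivial : forall W r, open_cover W -> projection id W [set` U] r ->
  ~ cohomologous 1 (nerve W) (fun s => c (map r s)) (fun=> 0)).
Context {k : nat} {a : 'I_k -> C} {m : C -> 'I_k -> int} {M : int}.
Context (c_coord : forall A B, A \in U -> B \in U ->
  c [:: A; B] = \sum_i (m (c [:: A; B]) i)%:~R * a i).
Context (m_bound : forall A B i, A \in U -> B \in U -> `|m (c [:: A; B]) i| <= M).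
Context (M_ge0 : 0 <= M).

(** x is the period of c along a closed walk in the nerve of a minimal subcover of
    V^n, and row j of y sums the coordinates of c along the image of this walk
    under a projection over f^j. *)
Lemma eigen_periods n : exists (x : C) (y : nat -> 'I_k -> int),
  [/\ x != 0,
      forall j, (j <= n)%N -> l ^+ j * x = \sum_i (y j i)%:~R * a i &
      forall j i, (j <= n)%N ->
        `|y j i| <= M *+ (2 * min_subcover_card (iterated_cover f V n))].
Proof.
have [r hr] := iterated_projection (f := f) V n.
have Vn_open := open_iterated_cover f_cont n V_open.
have [[S [SV ST Scard]] _] := min_subcoverP X_compact Vn_open.
have S_open : open_cover [set` S].
  by split=> // A /SV; exact: Vn_open.1.
have hrS j : (j <= n)%N -> projection (iter j f) [set` S] V (r j).
  by move=> jn A /SV; exact: hr.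
have r0 : projection id [set` S] [set` U] (p \o r 0%N).
  exact: projection_comp (hrS 0%N isT) p_proj.
have [A [w [ew lw sw x0]]] := nonzero_period (c_nontrivial S_open r0).
pose P j := p \o r j.
have edgeU j B D : (j <= n)%N -> nerve_edge [set` S] B D ->
    P j B \in U /\ P j D \in U.
  move=> jn /asboolP[BDS _]; have hPj := projection_comp (hrS j jn) p_proj.
  have [] := hPj B; first by apply: BDS; rewrite !inE eqxx.
  have [] := hPj D; first by apply: BDS; rewrite !inE eqxx orbT.
  by [].
exists (period (fun s => c (map (P 0%N) s)) A w).
exists (fun j i => walk_sum (fun B D => m (c [:: P j B; P j D]) i) A w).
split=> [//|j jn|j i jn].
  transitivity (period (fun s => c (map (P j) s)) A w); last first.
    apply: walk_sum_int_combination ew => B D /(edgeU _ _ _ jn)[PB PD].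
    exact: c_coord.
  rewrite (cohomologous_period (iterate_cohomologous c_cocycle p_proj rho_proj
    c_eigen hrS jn) ew lw).
  rewrite /period; elim: (w) (A) => [|B w' IH] A' /=; first by rewrite mulr0.
  by rewrite mulrDr IH.
rewrite (le_trans (walk_sum_norm_le (e := nerve_edge [set` S]) (M := M) _ ew))//.
  by move=> B D /(edgeU _ _ _ jn)[PB PD]; exact: m_bound.
by rewrite -Scard ler_wpMn2l.
Qed.

End Periods.

(** By compactness an eigenvector has a representative on a finite cover. The
    equation between classes is an equation between cocycles up to a coboundary
    on a common refinement V of U and of the preimage of U under f. *)
Lemma cech_eigenvector_cocycle (K : fieldType) (X : topologicalType) (q : nat)
    (f : X -> X) (f_cont : continuous f) (l : K) : compact [set: X] ->
  has_eigenvalue (cech_map K q f_cont) l ->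
  exists (U : {fset set X}) (V : set (set X)) (c : seq (set X) -> K) p rho,
    [/\ open_cover V, cocycle q (nerve [set` U]) c,
        projection id V [set` U] p, projection f V [set` U] rho &
        cohomologous q (nerve V) (fun s => c (map rho s))
                                 (fun s => l * c (map p s))] /\
    forall W r, open_cover W -> projection id W [set` U] r ->
      ~ cohomologous q (nerve W) (fun s => c (map r s)) (fun=> 0).
Proof.
move=> X_compact [v v0 vl]; have [U' [U'o [c' [hc' vE']]]] := cech_rep1 v.
have [U [UU' Uo]] := finite_subcover X_compact U'o.
have hU : projection id [set` U] U' id by move=> A /UU' U'A; split.
have [c [hc vE]] : exists c (hc : cocycle q (nerve [set` U]) c),
    v = \pi_(cech K X q) (CoverCocycle Uo hc).
  rewrite vE'; eexists _, _.
  exact: (@cech_pullback _ _ _ (CoverCocycle U'o hc') _ _ Uo hU).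
have [r0 hr0] := projection_preimage f [set` U].
have Po := open_cover_preimage f_cont Uo.
have fv := cech_mapE f_cont Uo hc Po hr0; have lv := cech_scaleE l Uo hc.
have [V [t [p [Vo ht hp h]]]] : limit_eq (CoverCocycle Po (cocycle_map hr0 hc))
    (CoverCocycle Uo (cocycleZ l hc)).
  by apply/cech_eqP; rewrite -fv -lv -vE.
exists U, V, c, p, (r0 \o t); split; first split => //.
  exact: projection_comp ht hr0.
  by apply: eq_cohomologous h => s //=; rewrite map_comp.
move=> W r Wo hr cW; case/eqP: v0; rewrite vE.
rewrite (@cech_pullback _ _ _ (CoverCocycle Uo hc) _ _ Wo hr).
by rewrite -[RHS]/cech_zero (cech_zeroE Wo); exact: cech_cohomologous.
Qed.

(** * Entropy from the growth of minimal subcovers *)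

Lemma polynomial_growth_ln (R : realType) (L K : R) (s : nat -> R) (d e : nat) :
  1 < L -> 0 <= K -> (forall n, 1 <= s n) ->
  (forall n, L ^+ n <= K * s (n + e)%N ^+ d.+1) ->
  exists K', forall n, n%:R * (ln L / d.+1%:R) - K' <= ln (s n).
Proof.
move=> L1 K0 s1 Ls; have L0 : 0 < L by exact: lt_trans L1.
(* The factor L ^+ e makes up for the shift, and K + 1 >= 1 covers n < e. *)
pose K1 := L ^+ e * (K + 1).
have Le : 1 <= L ^+ e by rewrite exprn_ege1// ltW.
have K10 : 0 < K1 by rewrite mulr_gt0// ?exprn_gt0// ltr_wpDl.
have LK1 n : L ^+ n <= K1 * s n ^+ d.+1.
  have sd : 1 <= s n ^+ d.+1 by rewrite exprn_ege1.
  have [en|ne] := leqP e n.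
    rewrite /K1 -{1}(subnK en) addnC exprD -mulrA.
    apply: ler_wpM2l; first exact: ltW (exprn_gt0 _ _).
    apply: le_trans (Ls _) _; rewrite subnK//.
    by rewrite ler_wpM2r ?(le_trans ler01)// lerDl.
  apply: (@le_trans _ _ (L ^+ e)); first by rewrite ler_eXn2l// ltnW.
  rewrite /K1 -mulrA; apply: ler_peMr; first exact: ltW (exprn_gt0 _ _).
  apply: (le_trans sd); apply: ler_peMl; first exact: le_trans sd.
  by rewrite lerDr.
clearbody K1.
exists (ln K1 / d.+1%:R) => n; have s0 : 0 < s n by exact: lt_le_trans (s1 n).
have := LK1 n; rewrite -ler_ln ?posrE ?exprn_gt0 ?mulr_gt0 ?exprn_gt0//.
rewrite lnM ?posrE ?exprn_gt0// !lnXn// => lnLe.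
rewrite mulrA -mulrBl ler_pdivrMr ?ltr0n// lerBlDl.
by rewrite mulr_natl mulr_natr.
Qed.

Theorem theorem26 (R : realType) (X : topologicalType) (f : X -> X)
    (X_compact : compact [set: X]) (f_cont : continuous f) (lambda : R[i])
    (lambda_eigenvalue : has_eigenvalue (cech_map R[i] 1 f_cont) lambda)
    (lambda_gt1 : 1 < ComplexField.Normc.normc lambda) :
  (exists d : nat,
     [/\ (0 < d)%N, algebraic_of_degree lambda d &
         ((ln (ComplexField.Normc.normc lambda) / d%:R)%:E
            <= topological_entropy R f)%E])
  /\ (0 < topological_entropy R f)%E.
Proof.
have [U [V [c [p [rho [[Vo hc hp hrho c_eigen] c_nontriv]]]]]] :=
  cech_eigenvector_cocycle X_compact lambda_eigenvalue.
(* On an empty space every cocycle is a coboundary. *)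
have [x0 _] : exists x : X, True.
  apply: contrapT => noX; apply: (c_nontriv V p Vo hp).
  by exists (fun=> 0) => // s [_ [x]]; case: noX; exists x.
pose values := [seq c [:: A; B] | A <- enum_fset U, B <- enum_fset U].
have [k [a [a_free a_span]]] := int_free_coordinates values.
have [m mP] : exists m : R[i] -> 'I_k -> int, forall v, v \in values ->
    v = \sum_i (m v i)%:~R * a i.
  have /choice[m mP] v : exists n : 'I_k -> int, v \in values ->
      v = \sum_i (n i)%:~R * a i.
    have [/a_span[n vn]|_] := boolP (v \in values); first by exists n.
    by exists (fun=> 0).
  by exists m.
have valuesP A B : A \in U -> B \in U -> c [:: A; B] \in values.
  by move=> AU BU; apply/allpairsP; exists (A, B).
pose M : int := \sum_(v <- values) \sum_i `|m v i|.
have M_ge0 : 0 <= M by rewrite sumr_ge0// => v _; rewrite sumr_ge0.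
have m_bound A B i : A \in U -> B \in U -> `|m (c [:: A; B]) i| <= M.
  move=> AU BU; rewrite /M (big_rem _ (valuesP A B AU BU)) /= (bigD1 i)//=.
  by rewrite -addrA lerDl addr_ge0// ?sumr_ge0// => v _; rewrite sumr_ge0.
have periods := eigen_periods X_compact f_cont Vo hc hp hrho c_eigen c_nontriv
  (fun A B AU BU => mP _ (valuesP A B AU BU)) m_bound M_ge0.
have [mu [mu_monic mu_irr mu_root]] : exists mu : {poly rat},
    [/\ mu \is monic, irreducible_poly mu & root (map_poly ratr mu) lambda].
  have [x [y [x_neq0 xy _]]] := periods k.
  have [q q0 q_root] := algebraic_of_int_coordinates x_neq0 xy.
  exact: minimal_polynomial_ex q0 q_root.
have [d mu_size] : exists d, size mu = d.+2.
  by have := mu_irr.1; case: (size mu) => [|[|d]]// _; exists d.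
pose L := ComplexField.Normc.normc lambda; rewrite -/L in lambda_gt1 *.
suff entropy_ge : ((ln L / d.+1%:R)%:E <= topological_entropy R f)%E.
  split; first by exists d.+1; split=> //; exists mu; split.
  by apply: lt_le_trans entropy_ge; rewrite lte_fin divr_gt0// ln_gt0.
have [K K0 growth] := eigenvalue_growth mu_monic mu_irr mu_root mu_size a_free.
pose s n : R := (min_subcover_card (iterated_cover f V n))%:R.
have s1 n : 1 <= s n.
  rewrite /s ler1n (min_subcover_card_gt0 X_compact x0)//.
  exact: open_iterated_cover.
pose K1 : R := complex.Re K * (2%:R * M%:~R) ^+ d.+1.
have K1_ge0 : 0 <= K1.
  rewrite mulr_ge0//; first by move: K0; case: (K) => [u v]; rewrite lecE => /andP[].
  by rewrite exprn_ge0// mulr_ge0// ler0z.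
have Ls n : L ^+ n <= K1 * s (n + d.*2)%N ^+ d.+1.
  have [x [y [x_neq0 xy yM]]] := periods (n + d.*2)%N.
  pose B : R := 2%:R * M%:~R * s (n + d.*2)%N.
  have : `|lambda| ^+ n <= K * (B%:C)%C ^+ d.+1.
    apply: growth x_neq0 xy _ => j i jn; rewrite -intr_norm.
    have -> : (B%:C)%C =
        (M *+ (2 * min_subcover_card (iterated_cover f V (n + d.*2))))%:~R.
      rewrite -(rmorph_int (real_complex R)) -mulr_natr intrM rmorph_nat natrM /B /s.
      by congr (_%:C)%C; ring.
    by rewrite ler_int yM.
  have -> : `|lambda| = (L%:C)%C by [].
  have -> : K = ((complex.Re K)%:C)%C by rewrite RRe_real// ger0_real.
  rewrite -!(rmorphXn (real_complex R)) -rmorphM lecR /K1 /B.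
  by rewrite [(_ * s _) ^+ _]exprMn mulrA.
have [K' lnK'] := polynomial_growth_ln lambda_gt1 K1_ge0 s1 Ls.
have cover_ge := cover_entropy_ge X_compact f_cont x0 Vo lnK'.
apply: (@le_trans _ _ (cover_entropy f V)%:E); first by rewrite lee_fin.
by apply: ereal_sup_ubound; exists V.
Qed.
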